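(* Let $\mathcal{C}$ be a semisimple abelian monoidal category with biexact tensor product. Then: (1) for any algebra $A$ in $\mathcal{C}$, the tensor functors $-\otimes A:\mathcal{C}\to\mathcal{C}_A$ and $A\otimes -:\mathcal{C}\to{}_A\mathcal{C}$ are semiseparable; (2) for any coalgebra $C$ in $\mathcal{C}$, the tensor functors $-\otimes C:\mathcal{C}\to\mathcal{C}^C$ and $C\otimes -:\mathcal{C}\to{}^C\mathcal{C}$ are semiseparable.
   Context: Monoidal categories are assumed strict, with tensor product $\otimes$ and unit object $1$. An abelian monoidal category is a monoidal category which is abelian with additive tensor product. A nonzero object is simple if $0$ and itself are its only subobjects; an abelian category is semisimple if every object is a direct sum of simple objects. For an algebra $(A,m_A,u_A)$ in $\mathcal{C}$, $\mathcal{C}_A$ (resp. ${}_A\mathcal{C}$) is the category of right (resp. left) $A$-modules in $\mathcal{C}$, and $-\otimes A:\mathcal{C}\to\mathcal{C}_A$ is $M\mapsto (M\otimes A, M\otimes m_A)$, $f\mapsto f\otimes A$; $A\otimes-$ is defined analogously. For a coalgebra $(C,\Delta_C,\varepsilon_C)$ in $\mathcal{C}$, $\mathcal{C}^C$ (resp. ${}^C\mathcal{C}$) is the category of right (resp. left) $C$-comodules in $\mathcal{C}$, and $-\otimes C:\mathcal{C}\to\mathcal{C}^C$ is $M\mapsto (M\otimes C, M\otimes\Delta_C)$, $f\mapsto f\otimes C$; $C\otimes-$ is defined analogously. For a functor $F:\mathcal{C}\to\mathcal{D}$ let $\mathcal{F}:\mathrm{Hom}_{\mathcal{C}}(-,-)\to\mathrm{Hom}_{\mathcal{D}}(F-,F-)$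 be the natural transformation $f\mapsto F(f)$. $F$ is semiseparable if there is a natural transformation $\mathcal{P}:\mathrm{Hom}_{\mathcal{D}}(F-,F-)\to\mathrm{Hom}_{\mathcal{C}}(-,-)$ with $\mathcal{F}\circ\mathcal{P}\circ\mathcal{F}=\mathcal{F}$. *)

(* Defs.v *)
From HB Require Import structures.
From mathcomp Require Import all_boot all_algebra.
From mathcomp Require Import boolp.

Set Implicit Arguments.
Unset Strict Implicit.
Unset Printing Implicit Defensive.

Import GRing.Theory.
Local Open Scope ring_scope.

Declare Scope cat_scope.
Delimit Scope cat_scope with cat.
Local Open Scope cat_scope.

Reserved Notation "g \oc f" (at level 40, left associativity).
Reserved Notation "X \ox Y" (at level 39, left associativity).
Reserved Notation "f \oxm g" (at level 39, left associativity).

HB.mixin Record HasHom (C : Type) := { hom : C -> C -> Type }.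

#[short(type="quiverType")]
HB.structure Definition Quiver := { C of HasHom C }.

HB.mixin Record IsCategory C of Quiver C := {
  idm : forall X : C, hom X X;
  compm : forall {X Y Z : C}, hom Y Z -> hom X Y -> hom X Z;
  comp1m : forall (X Y : C) (f : hom X Y), compm (idm Y) f = f;
  compm1 : forall (X Y : C) (f : hom X Y), compm f (idm X) = f;
  compmA : forall (X Y Z T : C) (h : hom Z T) (g : hom Y Z) (f : hom X Y),
    compm h (compm g f) = compm (compm h g) f
}.

#[short(type="categoryType")]
HB.structure Definition Category := { C of IsCategory C & HasHom C }.

Arguments idm {C} X : rename.
Arguments compm {C X Y Z} g f : rename.
Arguments comp1m {C X Y} f : rename.
Arguments compm1 {C X Y} f : rename.
Arguments compmA {C X Y Z T} h g f : rename.

Notation "g \oc f" := (compm g f) : cat_scope.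

Record functor (C D : categoryType) := Functor {
  fobj :> C -> D;
  fmap : forall X Y : C, hom X Y -> hom (fobj X) (fobj Y);
  fmap1 : forall X : C, fmap (idm X) = idm (fobj X);
  fmapM : forall (X Y Z : C) (g : hom Y Z) (f : hom X Y),
    fmap (g \oc f) = fmap g \oc fmap f
}.

Arguments fmap {C D} F {X Y} f : rename.

(* Naturality of a family Hom_D(F X, F Y) -> Hom_C(X, Y), both sides being
   functors C^op x C -> Set. *)
Definition hom_natural (C D : categoryType) (F : functor C D)
    (P : forall X Y : C, hom (F X) (F Y) -> hom X Y) : Prop :=
  forall (X X' Y Y' : C) (f : hom X' X) (g : hom Y Y') (h : hom (F X) (F Y)),
    P X' Y' (fmap F g \oc h \oc fmap F f) = g \oc P X Y h \oc f.

Definition semiseparable (C D : categoryType) (F : functor C D) : Prop :=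
  exists2 P : forall X Y : C, hom (F X) (F Y) -> hom X Y,
    hom_natural P &
    forall (X Y : C) (f : hom X Y), fmap F (P X Y (fmap F f)) = fmap F f.

Section CategoryTheory.
Variable C : categoryType.

Definition is_mono (X Y : C) (f : hom X Y) : Prop :=
  forall (Z : C) (g h : hom Z X), f \oc g = f \oc h -> g = h.

Definition is_epi (X Y : C) (f : hom X Y) : Prop :=
  forall (Z : C) (g h : hom Y Z), g \oc f = h \oc f -> g = h.

Definition is_iso (X Y : C) (f : hom X Y) : Prop :=
  exists2 g : hom Y X, g \oc f = idm X & f \oc g = idm Y.

Definition is_zero (X : C) : Prop :=
  forall Y : C, (exists! f : hom X Y, True) /\ (exists! f : hom Y X, True).

Definition is_product (X Y P : C) (p : hom P X) (q : hom P Y) : Prop :=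
  forall (Z : C) (f : hom Z X) (g : hom Z Y),
    exists! h : hom Z P, p \oc h = f /\ q \oc h = g.

Definition is_coproduct (I : Type) (S : I -> C) (X : C)
    (inj : forall i : I, hom (S i) X) : Prop :=
  forall (Y : C) (f : forall i : I, hom (S i) Y),
    exists! h : hom X Y, forall i : I, h \oc inj i = f i.

Definition is_simple (S : C) : Prop :=
  ~ is_zero S /\
  forall (Y : C) (i : hom Y S), is_mono i -> is_zero Y \/ is_iso i.

(* The index type of a direct sum is arbitrary, not necessarily finite. *)
Definition semisimple : Prop :=
  forall X : C, exists (I : Type) (S : I -> C) (inj : forall i, hom (S i) X),
    (forall i, is_simple (S i)) /\ is_coproduct inj.

(* Strictness of the monoidal structure is stated through these identities
   between objects that are equal but not convertible. *)
Definition eq_hom (X Y : C) (e : X = Y) : hom X Y :=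
  match e in _ = Z return hom X Z with erefl => idm X end.

Lemma eq_hom_irr (X Y : C) (e e' : X = Y) : eq_hom e = eq_hom e'.
Proof. by rewrite (Prop_irrelevance e e'). Qed.

Lemma eq_hom_id (X : C) (e : X = X) : eq_hom e = idm X.
Proof. exact: (eq_hom_irr e erefl). Qed.

Lemma eq_homM (X Y Z : C) (e : X = Y) (e' : Y = Z) :
  eq_hom e' \oc eq_hom e = eq_hom (etrans e e').
Proof. by case: _ / e'; rewrite /= comp1m. Qed.

End CategoryTheory.

(* Hom groups are zmodTypes; the choiceType structure that this includes is no
   restriction, since boolp equips every type with one. *)
HB.mixin Record HasHomZmod C of Quiver C := {
  hom_zmod : forall X Y : C, GRing.Zmodule (hom X Y)
}.

#[short(type="zmodQuiverType")]
HB.structure Definition ZmodQuiver := { C of HasHomZmod C & HasHom C }.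

HB.instance Definition _ (C : zmodQuiverType) (X Y : C) :
  GRing.Zmodule (hom X Y) := hom_zmod X Y.

HB.mixin Record IsPreadditive C of Category C & ZmodQuiver C := {
  compmDl : forall (X Y Z : C) (g g' : hom Y Z) (f : hom X Y),
    (g + g') \oc f = g \oc f + g' \oc f;
  compmDr : forall (X Y Z : C) (g : hom Y Z) (f f' : hom X Y),
    g \oc (f + f') = g \oc f + g \oc f'
}.

#[short(type="preadditiveType")]
HB.structure Definition Preadditive :=
  { C of IsPreadditive C & Category C & ZmodQuiver C }.

Section Preadditive.
Variable C : preadditiveType.

Definition is_kernel (X Y K : C) (f : hom X Y) (k : hom K X) : Prop :=
  f \oc k = 0 /\
  forall (Z : C) (h : hom Z X), f \oc h = 0 ->
    exists! u : hom Z K, k \oc u = h.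

Definition is_cokernel (X Y Q : C) (f : hom X Y) (q : hom Y Q) : Prop :=
  q \oc f = 0 /\
  forall (Z : C) (h : hom Y Z), h \oc f = 0 ->
    exists! u : hom Q Z, u \oc q = h.

Definition short_exact (X Y Z : C) (f : hom X Y) (g : hom Y Z) : Prop :=
  is_kernel g f /\ is_cokernel f g.

End Preadditive.

(* In a preadditive category, binary products are biproducts. *)
HB.mixin Record IsAbelian C of Preadditive C := {
  has_zero : exists Z : C, is_zero Z;
  has_product : forall X Y : C,
    exists (P : C) (p : hom P X) (q : hom P Y), is_product p q;
  has_kernel : forall (X Y : C) (f : hom X Y),
    exists (K : C) (k : hom K X), is_kernel f k;
  has_cokernel : forall (X Y : C) (f : hom X Y),
    exists (Q : C) (q : hom Y Q), is_cokernel f q;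
  mono_kernel : forall (K X : C) (k : hom K X), is_mono k ->
    exists (Y : C) (f : hom X Y), is_kernel f k;
  epi_cokernel : forall (Y Q : C) (q : hom Y Q), is_epi q ->
    exists (X : C) (f : hom X Y), is_cokernel f q
}.

#[short(type="abelianType")]
HB.structure Definition Abelian := { C of IsAbelian C & Preadditive C }.

Definition exact_functor (C D : preadditiveType) (F : functor C D) : Prop :=
  forall (X Y Z : C) (f : hom X Y) (g : hom Y Z),
    short_exact f g -> short_exact (fmap F f) (fmap F g).

HB.mixin Record IsStrictMonoidal C of Category C := {
  tens : C -> C -> C;
  tens1 : C;
  tensm : forall {X X' Y Y' : C},
    hom X X' -> hom Y Y' -> hom (tens X Y) (tens X' Y');
  tensm_id : forall X Y : C, tensm (idm X) (idm Y) = idm (tens X Y);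
  tensmM : forall (X X' X'' Y Y' Y'' : C)
      (g : hom X' X'') (f : hom X X') (g' : hom Y' Y'') (f' : hom Y Y'),
    tensm (g \oc f) (g' \oc f') = tensm g g' \oc tensm f f';
  tensoA : forall X Y Z : C, tens (tens X Y) Z = tens X (tens Y Z);
  tens1o : forall X : C, tens tens1 X = X;
  tenso1 : forall X : C, tens X tens1 = X;
  (* (f (x) g) (x) h = f (x) (g (x) h), 1 (x) f = f and f (x) 1 = f, with the
     equalities of objects above made explicit. *)
  tensmA : forall (X X' Y Y' Z Z' : C)
      (f : hom X X') (g : hom Y Y') (h : hom Z Z'),
    eq_hom (tensoA X' Y' Z') \oc tensm (tensm f g) h
    = tensm f (tensm g h) \oc eq_hom (tensoA X Y Z);
  tens1m : forall (X Y : C) (f : hom X Y),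
    eq_hom (tens1o Y) \oc tensm (idm tens1) f = f \oc eq_hom (tens1o X);
  tensm1 : forall (X Y : C) (f : hom X Y),
    eq_hom (tenso1 Y) \oc tensm f (idm tens1) = f \oc eq_hom (tenso1 X)
}.

#[short(type="monoidalType")]
HB.structure Definition Monoidal := { C of IsStrictMonoidal C & Category C }.

Arguments tens1 {C} : rename.
Arguments tensm {C X X' Y Y'} f g : rename.
Arguments tensmM {C X X' X'' Y Y' Y''} g f g' f' : rename.
Arguments tensmA {C X X' Y Y' Z Z'} f g h : rename.
Arguments tens1m {C X Y} f : rename.
Arguments tensm1 {C X Y} f : rename.

Notation "X \ox Y" := (tens X Y) : cat_scope.
Notation "f \oxm g" := (tensm f g) : cat_scope.

Section Monoidal.
Variable C : monoidalType.

Definition assocm (X Y Z : C) : hom (X \ox Y \ox Z) (X \ox (Y \ox Z)) :=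
  eq_hom (tensoA X Y Z).
Definition assocVm (X Y Z : C) : hom (X \ox (Y \ox Z)) (X \ox Y \ox Z) :=
  eq_hom (esym (tensoA X Y Z)).
Definition lunitm (X : C) : hom (tens1 \ox X) X := eq_hom (tens1o X).
Definition runitm (X : C) : hom (X \ox tens1) X := eq_hom (tenso1 X).

Lemma assocmV (X Y Z : C) : assocm X Y Z \oc assocVm X Y Z = idm _.
Proof. by rewrite /assocm /assocVm eq_homM eq_hom_id. Qed.

Lemma assocVmK (X Y Z : C) : assocVm X Y Z \oc assocm X Y Z = idm _.
Proof. by rewrite /assocm /assocVm eq_homM eq_hom_id. Qed.

Lemma assocm_nat (X X' Y Y' Z Z' : C)
    (f : hom X X') (g : hom Y Y') (h : hom Z Z') :
  assocm X' Y' Z' \oc ((f \oxm g) \oxm h)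
  = f \oxm (g \oxm h) \oc assocm X Y Z.
Proof. exact: tensmA. Qed.

Lemma assocVm_nat (X X' Y Y' Z Z' : C)
    (f : hom X X') (g : hom Y Y') (h : hom Z Z') :
  assocVm X' Y' Z' \oc (f \oxm (g \oxm h))
  = (f \oxm g) \oxm h \oc assocVm X Y Z.
Proof.
rewrite -[LHS]compm1 -(assocmV X Y Z) compmA -(compmA _ _ (assocm X Y Z)).
by rewrite -tensmA compmA assocVmK comp1m.
Qed.

Lemma tens_eq_homl (X Y Y' : C) (e : Y = Y') :
  idm X \oxm eq_hom e = eq_hom (f_equal (tens X) e).
Proof. by case: _ / e; rewrite /= tensm_id. Qed.

Lemma tens_eq_homr (X X' Y : C) (e : X = X') :
  eq_hom e \oxm idm Y = eq_hom (f_equal (tens^~ Y) e).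
Proof. by case: _ / e; rewrite /= tensm_id. Qed.

Lemma tensmMl (X Y Z T : C) (g : hom Y Z) (f : hom X Y) :
  (g \oc f) \oxm idm T = g \oxm idm T \oc (f \oxm idm T).
Proof. by rewrite -tensmM comp1m. Qed.

Lemma tensmMr (X Y Z T : C) (g : hom Y Z) (f : hom X Y) :
  idm T \oxm (g \oc f) = idm T \oxm g \oc (idm T \oxm f).
Proof. by rewrite -tensmM comp1m. Qed.

Lemma pentagon (X Y Z T : C) :
  assocm X Y (Z \ox T) \oc assocm (X \ox Y) Z T
  = (idm X \oxm assocm Y Z T) \oc assocm X (Y \ox Z) T
    \oc (assocm X Y Z \oxm idm T).
Proof.
by rewrite /assocm tens_eq_homl tens_eq_homr !eq_homM; exact: eq_hom_irr.
Qed.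

Definition rtensor (A : C) : functor C C :=
  Functor (fun X => tensm_id X A) (fun X Y Z g f => tensmMl A g f).

Definition ltensor (A : C) : functor C C :=
  Functor (fun X => tensm_id A X) (fun X Y Z g f => tensmMr A g f).

End Monoidal.

HB.mixin Record IsAdditiveMonoidal C of Preadditive C & Monoidal C := {
  tensmDl : forall (X X' Y Y' : C) (f f' : hom X X') (g : hom Y Y'),
    (f + f') \oxm g = f \oxm g + f' \oxm g;
  tensmDr : forall (X X' Y Y' : C) (f : hom X X') (g g' : hom Y Y'),
    f \oxm (g + g') = f \oxm g + f \oxm g'
}.

#[short(type="abelianMonoidalType")]
HB.structure Definition AbelianMonoidal :=
  { C of IsAdditiveMonoidal C & Abelian C & Monoidal C }.

Definition biexact_tensor (C : abelianMonoidalType) : Prop :=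
  forall X : C, exact_functor (ltensor X) /\ exact_functor (rtensor X).

Record algebra (C : monoidalType) := Algebra {
  alg_obj :> C;
  amul : hom (alg_obj \ox alg_obj) alg_obj;
  aunit : hom tens1 alg_obj;
  amulA : amul \oc (amul \oxm idm alg_obj)
    = amul \oc (idm alg_obj \oxm amul) \oc assocm alg_obj alg_obj alg_obj;
  amul1l : amul \oc (aunit \oxm idm alg_obj) = lunitm alg_obj;
  amul1r : amul \oc (idm alg_obj \oxm aunit) = runitm alg_obj
}.

Record coalgebra (C : monoidalType) := Coalgebra {
  coalg_obj :> C;
  comul : hom coalg_obj (coalg_obj \ox coalg_obj);
  counit : hom coalg_obj tens1;
  comulA : assocm coalg_obj coalg_obj coalg_obj
      \oc (comul \oxm idm coalg_obj) \oc comul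
    = (idm coalg_obj \oxm comul) \oc comul;
  comul1l : lunitm coalg_obj \oc (counit \oxm idm coalg_obj) \oc comul
    = idm coalg_obj;
  comul1r : runitm coalg_obj \oc (idm coalg_obj \oxm counit) \oc comul
    = idm coalg_obj
}.

Section Modules.
Variables (C : monoidalType) (A : algebra C).
Local Notation idA := (idm (alg_obj A)).

Record rmodule := RModule {
  rmod_obj :> C;
  ract : hom (rmod_obj \ox A) rmod_obj;
  ractA : ract \oc (ract \oxm idA)
    = ract \oc (idm rmod_obj \oxm amul A) \oc assocm rmod_obj A A;
  ract1 : ract \oc (idm rmod_obj \oxm aunit A) = runitm rmod_obj
}.

Record rmodule_hom (M N : rmodule) := RModuleHom {
  rmod_hom : hom (rmod_obj M) (rmod_obj N);
  rmod_homP : rmod_hom \oc ract M = ract N \oc (rmod_hom \oxm idA)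
}.

Lemma rmodule_hom_inj (M N : rmodule) : injective (@rmod_hom M N).
Proof.
move=> [f fP] [g gP] /= fg; case: _ / fg gP => gP.
by rewrite (Prop_irrelevance fP gP).
Qed.

Fact rmodule_idP (M : rmodule) :
  idm (rmod_obj M) \oc ract M = ract M \oc (idm (rmod_obj M) \oxm idA).
Proof. by rewrite tensm_id comp1m compm1. Qed.

Fact rmodule_compP (M N P : rmodule) (g : rmodule_hom N P) (f : rmodule_hom M N) :
  (rmod_hom g \oc rmod_hom f) \oc ract M
  = ract P \oc ((rmod_hom g \oc rmod_hom f) \oxm idA).
Proof. by rewrite -compmA rmod_homP compmA rmod_homP -compmA -tensmMl. Qed.

Definition rmodule_id (M : rmodule) : rmodule_hom M M := RModuleHom (rmodule_idP M).

Definition rmodule_comp (M N P : rmodule) (g : rmodule_hom N P) (f : rmodule_hom M N) :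
  rmodule_hom M P := RModuleHom (rmodule_compP g f).

HB.instance Definition _ := HasHom.Build rmodule rmodule_hom.

Fact rmodule_comp1m (M N : rmodule) (f : rmodule_hom M N) :
  rmodule_comp (rmodule_id N) f = f.
Proof. by apply: rmodule_hom_inj; rewrite /= comp1m. Qed.

Fact rmodule_compm1 (M N : rmodule) (f : rmodule_hom M N) :
  rmodule_comp f (rmodule_id M) = f.
Proof. by apply: rmodule_hom_inj; rewrite /= compm1. Qed.

Fact rmodule_compmA (M N P Q : rmodule)
    (h : rmodule_hom P Q) (g : rmodule_hom N P) (f : rmodule_hom M N) :
  rmodule_comp h (rmodule_comp g f) = rmodule_comp (rmodule_comp h g) f.
Proof. by apply: rmodule_hom_inj; rewrite /= compmA. Qed.

HB.instance Definition _ := @IsCategory.Build rmodule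
  rmodule_id rmodule_comp rmodule_comp1m rmodule_compm1 rmodule_compmA.

Definition free_ract (M : C) : hom (M \ox A \ox A) (M \ox A) :=
  (idm M \oxm amul A) \oc assocm M A A.

Fact free_ractA (M : C) :
  free_ract M \oc (free_ract M \oxm idA)
  = free_ract M \oc (idm (M \ox A) \oxm amul A) \oc assocm (M \ox A) A A.
Proof.
rewrite /free_ract tensmMl -tensm_id -!compmA.
rewrite [in LHS](compmA (assocm _ _ _)) [in RHS](compmA (assocm _ _ _)).
rewrite !assocm_nat -!compmA pentagon.
by rewrite !compmA -!tensmMr amulA.
Qed.

Fact free_ract1 (M : C) :
  free_ract M \oc (idm (M \ox A) \oxm aunit A) = runitm (M \ox A).
Proof.
rewrite /free_ract -compmA -tensm_id assocm_nat compmA -tensmMr amul1r.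
by rewrite /assocm /runitm tens_eq_homl eq_homM; exact: eq_hom_irr.
Qed.

Fact free_ract_nat (M N : C) (f : hom M N) :
  (f \oxm idA) \oc free_ract M = free_ract N \oc ((f \oxm idA) \oxm idA).
Proof.
by rewrite /free_ract -compmA assocm_nat !compmA -!tensmM tensm_id !comp1m !compm1.
Qed.

Definition free_rmodule (M : C) : rmodule :=
  RModule (free_ractA M) (free_ract1 M).

Definition free_rmodule_map (M N : C) (f : hom M N) :
    hom (free_rmodule M) (free_rmodule N) :=
  @RModuleHom (free_rmodule M) (free_rmodule N) (f \oxm idA) (free_ract_nat f).

Fact free_rmodule_map1 (M : C) : free_rmodule_map (idm M) = idm (free_rmodule M).
Proof. by apply: rmodule_hom_inj; rewrite /= tensm_id. Qed.

Fact free_rmodule_mapM (M N P : C) (g : hom N P) (f : hom M N) :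
  free_rmodule_map (g \oc f) = free_rmodule_map g \oc free_rmodule_map f.
Proof. by apply: rmodule_hom_inj; rewrite /= tensmMl. Qed.

Definition tensor_rmodule : functor C rmodule :=
  Functor free_rmodule_map1 free_rmodule_mapM.

Record lmodule := LModule {
  lmod_obj :> C;
  lact : hom (A \ox lmod_obj) lmod_obj;
  lactA : lact \oc (amul A \oxm idm lmod_obj)
    = lact \oc (idA \oxm lact) \oc assocm A A lmod_obj;
  lact1 : lact \oc (aunit A \oxm idm lmod_obj) = lunitm lmod_obj
}.

Record lmodule_hom (M N : lmodule) := LModuleHom {
  lmod_hom : hom (lmod_obj M) (lmod_obj N);
  lmod_homP : lmod_hom \oc lact M = lact N \oc (idA \oxm lmod_hom)
}.

Lemma lmodule_hom_inj (M N : lmodule) : injective (@lmod_hom M N).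
Proof.
move=> [f fP] [g gP] /= fg; case: _ / fg gP => gP.
by rewrite (Prop_irrelevance fP gP).
Qed.

Fact lmodule_idP (M : lmodule) :
  idm (lmod_obj M) \oc lact M = lact M \oc (idA \oxm idm (lmod_obj M)).
Proof. by rewrite tensm_id comp1m compm1. Qed.

Fact lmodule_compP (M N P : lmodule) (g : lmodule_hom N P) (f : lmodule_hom M N) :
  (lmod_hom g \oc lmod_hom f) \oc lact M
  = lact P \oc (idA \oxm (lmod_hom g \oc lmod_hom f)).
Proof. by rewrite -compmA lmod_homP compmA lmod_homP -compmA -tensmMr. Qed.

Definition lmodule_id (M : lmodule) : lmodule_hom M M := LModuleHom (lmodule_idP M).

Definition lmodule_comp (M N P : lmodule) (g : lmodule_hom N P) (f : lmodule_hom M N) :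
  lmodule_hom M P := LModuleHom (lmodule_compP g f).

HB.instance Definition _ := HasHom.Build lmodule lmodule_hom.

Fact lmodule_comp1m (M N : lmodule) (f : lmodule_hom M N) :
  lmodule_comp (lmodule_id N) f = f.
Proof. by apply: lmodule_hom_inj; rewrite /= comp1m. Qed.

Fact lmodule_compm1 (M N : lmodule) (f : lmodule_hom M N) :
  lmodule_comp f (lmodule_id M) = f.
Proof. by apply: lmodule_hom_inj; rewrite /= compm1. Qed.

Fact lmodule_compmA (M N P Q : lmodule)
    (h : lmodule_hom P Q) (g : lmodule_hom N P) (f : lmodule_hom M N) :
  lmodule_comp h (lmodule_comp g f) = lmodule_comp (lmodule_comp h g) f.
Proof. by apply: lmodule_hom_inj; rewrite /= compmA. Qed.

HB.instance Definition _ := @IsCategory.Build lmodule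
  lmodule_id lmodule_comp lmodule_comp1m lmodule_compm1 lmodule_compmA.

Definition free_lact (M : C) : hom (A \ox (A \ox M)) (A \ox M) :=
  (amul A \oxm idm M) \oc assocVm A A M.

Fact free_lactA (M : C) :
  free_lact M \oc (amul A \oxm idm (A \ox M))
  = free_lact M \oc (idA \oxm free_lact M) \oc assocm A A (A \ox M).
Proof.
rewrite /free_lact tensmMr -tensm_id -!compmA.
rewrite [X in _ \oc X = _]assocVm_nat (compmA (assocVm _ _ _)) assocVm_nat.
rewrite !compmA -!tensmMl amulA tensmMl -!compmA; congr (_ \oc _).
rewrite /assocm /assocVm tens_eq_homl tens_eq_homr !eq_homM.
exact: eq_hom_irr.
Qed.

Fact free_lact1 (M : C) :
  free_lact M \oc (aunit A \oxm idm (A \ox M)) = lunitm (A \ox M).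
Proof.
rewrite /free_lact -compmA -tensm_id assocVm_nat compmA -tensmMl amul1l.
by rewrite /assocVm /lunitm tens_eq_homr eq_homM; exact: eq_hom_irr.
Qed.

Fact free_lact_nat (M N : C) (f : hom M N) :
  (idA \oxm f) \oc free_lact M = free_lact N \oc (idA \oxm (idA \oxm f)).
Proof.
by rewrite /free_lact -compmA assocVm_nat !compmA -!tensmM tensm_id !comp1m !compm1.
Qed.

Definition free_lmodule (M : C) : lmodule :=
  LModule (free_lactA M) (free_lact1 M).

Definition free_lmodule_map (M N : C) (f : hom M N) :
    hom (free_lmodule M) (free_lmodule N) :=
  @LModuleHom (free_lmodule M) (free_lmodule N) (idA \oxm f) (free_lact_nat f).

Fact free_lmodule_map1 (M : C) : free_lmodule_map (idm M) = idm (free_lmodule M).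
Proof. by apply: lmodule_hom_inj; rewrite /= tensm_id. Qed.

Fact free_lmodule_mapM (M N P : C) (g : hom N P) (f : hom M N) :
  free_lmodule_map (g \oc f) = free_lmodule_map g \oc free_lmodule_map f.
Proof. by apply: lmodule_hom_inj; rewrite /= tensmMr. Qed.

Definition tensor_lmodule : functor C lmodule :=
  Functor free_lmodule_map1 free_lmodule_mapM.

End Modules.

Section Comodules.
Variables (C : monoidalType) (D : coalgebra C).
Local Notation idD := (idm (coalg_obj D)).

Record rcomodule := RComodule {
  rcomod_obj :> C;
  rcoact : hom rcomod_obj (rcomod_obj \ox D);
  rcoactA : assocm rcomod_obj D D \oc (rcoact \oxm idD) \oc rcoact
    = (idm rcomod_obj \oxm comul D) \oc rcoact;
  rcoact1 : runitm rcomod_obj \oc (idm rcomod_obj \oxm counit D) \oc rcoact = idm rcomod_obj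
}.

Record rcomodule_hom (M N : rcomodule) := RComoduleHom {
  rcomod_hom : hom (rcomod_obj M) (rcomod_obj N);
  rcomod_homP : rcoact N \oc rcomod_hom = (rcomod_hom \oxm idD) \oc rcoact M
}.

Lemma rcomodule_hom_inj (M N : rcomodule) : injective (@rcomod_hom M N).
Proof.
move=> [f fP] [g gP] /= fg; case: _ / fg gP => gP.
by rewrite (Prop_irrelevance fP gP).
Qed.

Fact rcomodule_idP (M : rcomodule) :
  rcoact M \oc idm (rcomod_obj M) = (idm (rcomod_obj M) \oxm idD) \oc rcoact M.
Proof. by rewrite tensm_id comp1m compm1. Qed.

Fact rcomodule_compP (M N P : rcomodule) (g : rcomodule_hom N P) (f : rcomodule_hom M N) :
  rcoact P \oc (rcomod_hom g \oc rcomod_hom f)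
  = ((rcomod_hom g \oc rcomod_hom f) \oxm idD) \oc rcoact M.
Proof. by rewrite compmA rcomod_homP -compmA rcomod_homP compmA -tensmMl. Qed.

Definition rcomodule_id (M : rcomodule) : rcomodule_hom M M := RComoduleHom (rcomodule_idP M).

Definition rcomodule_comp (M N P : rcomodule) (g : rcomodule_hom N P) (f : rcomodule_hom M N) :
  rcomodule_hom M P := RComoduleHom (rcomodule_compP g f).

HB.instance Definition _ := HasHom.Build rcomodule rcomodule_hom.

Fact rcomodule_comp1m (M N : rcomodule) (f : rcomodule_hom M N) :
  rcomodule_comp (rcomodule_id N) f = f.
Proof. by apply: rcomodule_hom_inj; rewrite /= comp1m. Qed.

Fact rcomodule_compm1 (M N : rcomodule) (f : rcomodule_hom M N) :
  rcomodule_comp f (rcomodule_id M) = f.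
Proof. by apply: rcomodule_hom_inj; rewrite /= compm1. Qed.

Fact rcomodule_compmA (M N P Q : rcomodule)
    (h : rcomodule_hom P Q) (g : rcomodule_hom N P) (f : rcomodule_hom M N) :
  rcomodule_comp h (rcomodule_comp g f) = rcomodule_comp (rcomodule_comp h g) f.
Proof. by apply: rcomodule_hom_inj; rewrite /= compmA. Qed.

HB.instance Definition _ := @IsCategory.Build rcomodule
  rcomodule_id rcomodule_comp rcomodule_comp1m rcomodule_compm1 rcomodule_compmA.

Definition cofree_rcoact (M : C) : hom (M \ox D) (M \ox D \ox D) :=
  assocVm M D D \oc (idm M \oxm comul D).

Fact cofree_rcoactA (M : C) :
  assocm (M \ox D) D D \oc (cofree_rcoact M \oxm idD) \oc cofree_rcoact M
  = (idm (M \ox D) \oxm comul D) \oc cofree_rcoact M.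
Proof.
rewrite /cofree_rcoact tensmMl -tensm_id -!compmA.
rewrite (compmA _ (assocVm M D D)) -assocVm_nat.
rewrite (compmA _ (assocVm M D D)) -assocVm_nat -!compmA -!tensmMr -comulA.
rewrite -[in RHS]compmA [in RHS]tensmMr !compmA; congr (_ \oc _).
rewrite /assocm /assocVm tens_eq_homl tens_eq_homr !eq_homM.
exact: eq_hom_irr.
Qed.

Fact cofree_rcoact1 (M : C) :
  runitm (M \ox D) \oc (idm (M \ox D) \oxm counit D) \oc cofree_rcoact M
  = idm (M \ox D).
Proof.
rewrite /cofree_rcoact -tensm_id -compmA (compmA _ (assocVm _ _ _)).
rewrite -assocVm_nat -compmA -tensmMr -[in RHS](comul1r D) -[in RHS]compmA.
rewrite [in RHS]tensmMr compmA; congr (_ \oc _).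
by rewrite /assocVm /runitm tens_eq_homl eq_homM; exact: eq_hom_irr.
Qed.

Fact cofree_rcoact_nat (M N : C) (f : hom M N) :
  cofree_rcoact N \oc (f \oxm idD)
  = ((f \oxm idD) \oxm idD) \oc cofree_rcoact M.
Proof.
by rewrite /cofree_rcoact compmA -assocVm_nat -!compmA -!tensmM tensm_id !comp1m !compm1.
Qed.

Definition cofree_rcomodule (M : C) : rcomodule :=
  RComodule (cofree_rcoactA M) (cofree_rcoact1 M).

Definition cofree_rcomodule_map (M N : C) (f : hom M N) :
    hom (cofree_rcomodule M) (cofree_rcomodule N) :=
  @RComoduleHom (cofree_rcomodule M) (cofree_rcomodule N) (f \oxm idD) (cofree_rcoact_nat f).

Fact cofree_rcomodule_map1 (M : C) : cofree_rcomodule_map (idm M) = idm (cofree_rcomodule M).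
Proof. by apply: rcomodule_hom_inj; rewrite /= tensm_id. Qed.

Fact cofree_rcomodule_mapM (M N P : C) (g : hom N P) (f : hom M N) :
  cofree_rcomodule_map (g \oc f) = cofree_rcomodule_map g \oc cofree_rcomodule_map f.
Proof. by apply: rcomodule_hom_inj; rewrite /= tensmMl. Qed.

Definition tensor_rcomodule : functor C rcomodule :=
  Functor cofree_rcomodule_map1 cofree_rcomodule_mapM.

Record lcomodule := LComodule {
  lcomod_obj :> C;
  lcoact : hom lcomod_obj (D \ox lcomod_obj);
  lcoactA : assocm D D lcomod_obj \oc (comul D \oxm idm lcomod_obj) \oc lcoact
    = (idD \oxm lcoact) \oc lcoact;
  lcoact1 : lunitm lcomod_obj \oc (counit D \oxm idm lcomod_obj) \oc lcoact = idm lcomod_obj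
}.

Record lcomodule_hom (M N : lcomodule) := LComoduleHom {
  lcomod_hom : hom (lcomod_obj M) (lcomod_obj N);
  lcomod_homP : lcoact N \oc lcomod_hom = (idD \oxm lcomod_hom) \oc lcoact M
}.

Lemma lcomodule_hom_inj (M N : lcomodule) : injective (@lcomod_hom M N).
Proof.
move=> [f fP] [g gP] /= fg; case: _ / fg gP => gP.
by rewrite (Prop_irrelevance fP gP).
Qed.

Fact lcomodule_idP (M : lcomodule) :
  lcoact M \oc idm (lcomod_obj M) = (idD \oxm idm (lcomod_obj M)) \oc lcoact M.
Proof. by rewrite tensm_id comp1m compm1. Qed.

Fact lcomodule_compP (M N P : lcomodule) (g : lcomodule_hom N P) (f : lcomodule_hom M N) :
  lcoact P \oc (lcomod_hom g \oc lcomod_hom f)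
  = (idD \oxm (lcomod_hom g \oc lcomod_hom f)) \oc lcoact M.
Proof. by rewrite compmA lcomod_homP -compmA lcomod_homP compmA -tensmMr. Qed.

Definition lcomodule_id (M : lcomodule) : lcomodule_hom M M := LComoduleHom (lcomodule_idP M).

Definition lcomodule_comp (M N P : lcomodule) (g : lcomodule_hom N P) (f : lcomodule_hom M N) :
  lcomodule_hom M P := LComoduleHom (lcomodule_compP g f).

HB.instance Definition _ := HasHom.Build lcomodule lcomodule_hom.

Fact lcomodule_comp1m (M N : lcomodule) (f : lcomodule_hom M N) :
  lcomodule_comp (lcomodule_id N) f = f.
Proof. by apply: lcomodule_hom_inj; rewrite /= comp1m. Qed.

Fact lcomodule_compm1 (M N : lcomodule) (f : lcomodule_hom M N) :
  lcomodule_comp f (lcomodule_id M) = f.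
Proof. by apply: lcomodule_hom_inj; rewrite /= compm1. Qed.

Fact lcomodule_compmA (M N P Q : lcomodule)
    (h : lcomodule_hom P Q) (g : lcomodule_hom N P) (f : lcomodule_hom M N) :
  lcomodule_comp h (lcomodule_comp g f) = lcomodule_comp (lcomodule_comp h g) f.
Proof. by apply: lcomodule_hom_inj; rewrite /= compmA. Qed.

HB.instance Definition _ := @IsCategory.Build lcomodule
  lcomodule_id lcomodule_comp lcomodule_comp1m lcomodule_compm1 lcomodule_compmA.

Definition cofree_lcoact (M : C) : hom (D \ox M) (D \ox (D \ox M)) :=
  assocm D D M \oc (comul D \oxm idm M).

Fact cofree_lcoactA (M : C) :
  assocm D D (D \ox M) \oc (comul D \oxm idm (D \ox M)) \oc cofree_lcoact M
  = (idD \oxm cofree_lcoact M) \oc cofree_lcoact M.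
Proof.
rewrite /cofree_lcoact tensmMr -tensm_id -!compmA.
rewrite (compmA _ (assocm D D M)) -assocm_nat.
rewrite (compmA _ (assocm D D M)) -assocm_nat -!compmA -!tensmMl -comulA.
rewrite -[in RHS]compmA [in RHS]tensmMl !compmA; congr (_ \oc _).
by rewrite /assocm tens_eq_homl tens_eq_homr !eq_homM; exact: eq_hom_irr.
Qed.

Fact cofree_lcoact1 (M : C) :
  lunitm (D \ox M) \oc (counit D \oxm idm (D \ox M)) \oc cofree_lcoact M
  = idm (D \ox M).
Proof.
rewrite /cofree_lcoact -tensm_id -compmA (compmA _ (assocm _ _ _)).
rewrite -assocm_nat -compmA -tensmMl -[in RHS](comul1l D) -[in RHS]compmA.
rewrite [in RHS]tensmMl compmA; congr (_ \oc _).
by rewrite /assocm /lunitm tens_eq_homr eq_homM; exact: eq_hom_irr.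
Qed.

Fact cofree_lcoact_nat (M N : C) (f : hom M N) :
  cofree_lcoact N \oc (idD \oxm f)
  = (idD \oxm (idD \oxm f)) \oc cofree_lcoact M.
Proof.
by rewrite /cofree_lcoact compmA -assocm_nat -!compmA -!tensmM tensm_id !comp1m !compm1.
Qed.

Definition cofree_lcomodule (M : C) : lcomodule :=
  LComodule (cofree_lcoactA M) (cofree_lcoact1 M).

Definition cofree_lcomodule_map (M N : C) (f : hom M N) :
    hom (cofree_lcomodule M) (cofree_lcomodule N) :=
  @LComoduleHom (cofree_lcomodule M) (cofree_lcomodule N) (idD \oxm f) (cofree_lcoact_nat f).

Fact cofree_lcomodule_map1 (M : C) : cofree_lcomodule_map (idm M) = idm (cofree_lcomodule M).
Proof. by apply: lcomodule_hom_inj; rewrite /= tensm_id. Qed.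

Fact cofree_lcomodule_mapM (M N P : C) (g : hom N P) (f : hom M N) :
  cofree_lcomodule_map (g \oc f) = cofree_lcomodule_map g \oc cofree_lcomodule_map f.
Proof. by apply: lcomodule_hom_inj; rewrite /= tensmMr. Qed.

Definition tensor_lcomodule : functor C lcomodule :=
  Functor cofree_lcomodule_map1 cofree_lcomodule_mapM.

End Comodules.

(* Main.v *)
From mathcomp Require Import all_boot all_algebra.
From mathcomp Require Import boolp.
Require Import Defs.

(** The four functors share one mechanism.  Let [u : 1 -> A] be the unit of an
    algebra.  If [u] has a quasi-inverse [x : A -> 1], that is [u x u = u], then
    multiplying [u x u (x) A = u (x) A] on the left by [m] and using
    [m (u (x) A) = id], or its mirror image, shows that the scalar
    [x u : 1 -> 1] becomes the identity after tensoring with [A], on either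
    side ([algebra_absorbs]).  Hence the natural loop
    [M -> M (x) A -> M] induced by [u] and [x] is sent to the identity by
    [- (x) A].  Inserting a morphism [h : M (x) A -> N (x) A] in the middle of
    that loop, [P h := (N (x) x) h (M (x) u)], gives the natural transformation
    required by semiseparability, because [P (f (x) A)] is [f] followed by the
    loop ([semiseparable_inert]).  For a coalgebra the counit
    [e : D -> 1] and a quasi-inverse [y : 1 -> D] play the same part, with the
    scalar [e y].

    It remains to see that every morphism of a semisimple abelian category has a
    quasi-inverse ([semisimple_regular]).  Factoring a morphism through its
    image, this follows once every epimorphism [q : X -> Y] splits.  As [Y] is a
    coproduct of simple objects, it is enough to lift each of its simple summands
    [T] along [q], that is to show that simple objects are projective
    ([simple_projective]).  The pullback of [X] and [T] over [Y] maps nontrivially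
    to [T]; being itself a coproduct of simple objects it has a simple summand on
    which this map is nonzero, hence invertible by Schur's lemma.  The
    argument uses direct sums through their universal property alone, so it
    covers infinite ones. *)

Set Implicit Arguments.
Unset Strict Implicit.
Unset Printing Implicit Defensive.

Import GRing.Theory.
Local Open Scope ring_scope.
Local Open Scope cat_scope.

(** * Composition in preadditive categories *)

Section Preadditive.
Variable C : preadditiveType.
Implicit Types X Y Z : C.

Lemma comp0m X Y Z (f : hom X Y) : (0 : hom Y Z) \oc f = 0.
Proof. by apply: (addIr (0 \oc f)); rewrite -compmDl !add0r. Qed.

Lemma compm0 X Y Z (g : hom Y Z) : g \oc (0 : hom X Y) = 0.
Proof. by apply: (addIr (g \oc 0)); rewrite -compmDr !add0r. Qed.

Lemma compmBl X Y Z (g g' : hom Y Z) (f : hom X Y) :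
  (g - g') \oc f = g \oc f - g' \oc f.
Proof. by apply/eqP; rewrite eq_sym subr_eq -compmDl subrK. Qed.

Lemma compmBr X Y Z (g : hom Y Z) (f f' : hom X Y) :
  g \oc (f - f') = g \oc f - g \oc f'.
Proof. by apply/eqP; rewrite eq_sym subr_eq -compmDr subrK. Qed.

Lemma zero_mor_to X Z (f : hom X Z) : is_zero Z -> f = 0.
Proof. by move=> /(_ X)[_ [u [_ Pu]]]; rewrite -(Pu f I) (Pu 0 I). Qed.

Lemma is_zero_idm X : idm X = 0 -> is_zero X.
Proof.
move=> X0 Y; split; exists 0; split=> // f _.
  by rewrite -[f]compm1 X0 compm0.
by rewrite -[f]comp1m X0 comp0m.
Qed.

Lemma is_monoP X Y (f : hom X Y) :
  (forall Z (g : hom Z X), f \oc g = 0 -> g = 0) -> is_mono f.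
Proof.
move=> f0 Z g h fgh; apply/eqP; rewrite -subr_eq0; apply/eqP/f0.
by rewrite compmBr fgh subrr.
Qed.

Lemma is_epiP X Y (f : hom X Y) :
  (forall Z (g : hom Y Z), g \oc f = 0 -> g = 0) -> is_epi f.
Proof.
move=> f0 Z g h fgh; apply/eqP; rewrite -subr_eq0; apply/eqP/f0.
by rewrite compmBl fgh subrr.
Qed.

Lemma epi_eq0 X Y Z (f : hom X Y) (g : hom Y Z) :
  is_epi f -> g \oc f = 0 -> g = 0.
Proof. by move=> epi_f gf0; apply: epi_f; rewrite gf0 comp0m. Qed.

Lemma kernel_mono X Y K (f : hom X Y) (k : hom K X) :
  is_kernel f k -> is_mono k.
Proof.
move=> [fk0 kP] Z g h kgh.
have fkg0 : f \oc (k \oc g) = 0 by rewrite compmA fk0 comp0m.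
have [v [_ vP]] := kP _ _ fkg0.
by rewrite -(vP g erefl) (vP h (esym kgh)).
Qed.

(** Finds, in a decomposition into simple objects, a summand to which Schur's
    lemma applies. *)
Lemma coproduct_nonzero (I : Type) (S : I -> C) X Y
    (inj : forall i, hom (S i) X) (f : hom X Y) :
  is_coproduct inj -> f <> 0 -> exists i, f \oc inj i <> 0.
Proof.
move=> injP f0; apply: contrapT => /forallNP fi0; apply: f0.
have [h [_ hP]] := injP Y (fun=> 0).
rewrite -(hP f); last by move=> i; apply: contrapT; exact: fi0.
by apply: hP => i; rewrite comp0m.
Qed.

End Preadditive.

(** * Images and Schur's lemma in abelian categories *)

Section Abelian.
Variable C : abelianType.
Implicit Types X Y Z : C.

(** An epimorphism is the cokernel of some [f], and [f] factors through the
    kernel, so a morphism killing the kernel kills [f]. *)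
Lemma epi_factor_kernel X Y Z K (q : hom X Y) (k : hom K X) (h : hom X Z) :
  is_epi q -> is_kernel q k -> h \oc k = 0 -> exists w, w \oc q = h.
Proof.
move=> /epi_cokernel [W [f [qf0 fP]]] [_ kP] hk0.
have [v [kv _]] := kP _ _ qf0.
have hf0 : h \oc f = 0 by rewrite -kv compmA hk0 comp0m.
by have [w [wq _]] := fP _ _ hf0; exists w.
Qed.

(** The image is the kernel of the cokernel [q] of [u].  The first factor [e] is
    an epimorphism because any subobject [k] of the image through which [e]
    factors is a kernel of some [f] in [Y]; such an [f] kills [u], hence factors
    through [q], hence kills the whole image. *)
Lemma image_factorization X Y (u : hom X Y) :
  exists (I Q : C) (e : hom X I) (m : hom I Y) (q : hom Y Q),
    [/\ u = m \oc e, is_epi e, is_epi q & is_kernel q m].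
Proof.
have [Q [q [qu0 qP]]] := has_cokernel _ _ u.
have [I [m mP]] := has_kernel _ _ q.
have m_mono := kernel_mono mP.
have [qm0 mU] := mP; have [e [me _]] := mU _ _ qu0.
exists I, Q, e, m, q; split=> //.
- apply: is_epiP => Z h he0.
  have [K [k kP]] := has_kernel _ _ h; have k_mono := kernel_mono kP.
  have [hk0 kU] := kP; have [e' [ke' _]] := kU _ _ he0.
  have mk_mono : is_mono (m \oc k).
    by move=> T g g'; rewrite -!compmA => /m_mono /k_mono.
  have [T [f [fmk0 fU]]] := mono_kernel _ _ _ mk_mono.
  have fu0 : f \oc u = 0 by rewrite -me -ke' !compmA -(compmA f) fmk0 comp0m.
  have [f' [f'q _]] := qP _ _ fu0.
  have fm0 : f \oc m = 0 by rewrite -f'q -compmA qm0 compm0.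
  have [s [mks _]] := fU _ _ fm0.
  have ks1 : k \oc s = idm I by apply: m_mono; rewrite compmA compm1.
  by rewrite -[h]compm1 -ks1 compmA hk0 comp0m.
- apply: is_epiP => Z h hq0; have hqu0 : (0 : hom Y Z) \oc u = 0 := comp0m _ u.
  have [w [_ wU]] := qP _ _ hqu0.
  by rewrite -(wU h hq0) (wU 0 (comp0m _ q)).
Qed.

Lemma schur (R T : C) (f : hom R T) :
  is_simple R -> is_simple T -> f <> 0 -> is_iso f.
Proof.
move=> [R0 R_simple] [_ T_simple] f0.
have [K [k kP]] := has_kernel _ _ f; have [fk0 kU] := kP.
case: (R_simple K k (kernel_mono kP)) => [K0|[g _ kg]]; last first.
  by case: f0; rewrite -[f]compm1 -kg compmA fk0 comp0m.
have f_mono : is_mono f.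
  apply: is_monoP => Z g fg0; have [v [<- _]] := kU _ _ fg0.
  by rewrite (zero_mor_to v K0) compm0.
by case: (T_simple R f f_mono).
Qed.

(** * Splitting in semisimple abelian categories *)

(** The pullback [E] of [q] and [t] is the kernel of [q p1 - t p2] on the
    product.  If its projection to [T] were zero, the projection [p2] would
    factor through the epimorphism [q p1 - t p2], say as [w]; restricting to
    [X] gives [w q = 0], so [w = 0] and [p2 = 0], against [T] being nonzero.  A
    simple summand of [E] on which the projection is nonzero is then isomorphic
    to [T], and its inclusion in [E] yields the lift. *)
Lemma simple_projective X Y (T : C) (q : hom X Y) (t : hom T Y) :
  semisimple C -> is_epi q -> is_simple T -> exists l : hom T X, q \oc l = t.
Proof.
move=> C_ss q_epi T_simple.
have [P [p1 [p2 prodP]]] := has_product X T.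
have [i1 [[p1i1 p2i1] _]] := prodP X (idm X) 0.
have [i2 [[_ p2i2] _]] := prodP T 0 (idm T).
pose d := q \oc p1 - t \oc p2.
have di1 : d \oc i1 = q.
  by rewrite compmBl -!compmA p1i1 p2i1 compm1 compm0 subr0.
have d_epi : is_epi d.
  apply: is_epiP => Z h hd0; apply: (epi_eq0 q_epi).
  by rewrite -di1 compmA hd0 comp0m.
have [E [k kP]] := has_kernel _ _ d.
have p2k0 : p2 \oc k <> 0.
  move=> /(epi_factor_kernel d_epi kP)[w wd].
  have w0 : w = 0 by apply: (epi_eq0 q_epi); rewrite -di1 compmA wd.
  case: T_simple => T0 _; apply/T0/is_zero_idm.
  by rewrite -p2i2 -wd w0 !comp0m.
have [I [S [inj [S_simple injP]]]] := C_ss E.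
have [i p2ki0] := coproduct_nonzero injP p2k0.
have [g _ p2kig] := schur (S_simple i) T_simple p2ki0.
exists (p1 \oc k \oc inj i \oc g).
have [dk0 _] := kP; have qp1k : q \oc p1 \oc k = t \oc p2 \oc k.
  by apply/eqP; rewrite -subr_eq0 -compmBl; apply/eqP.
by rewrite !compmA qp1k -!compmA (compmA p2) (compmA (p2 \oc k)) p2kig compm1.
Qed.

Lemma semisimple_epi_split X Y (q : hom X Y) :
  semisimple C -> is_epi q -> exists s, q \oc s = idm Y.
Proof.
move=> C_ss q_epi; have [I [S [inj [S_simple injP]]]] := C_ss Y.
have lift i : {l : hom (S i) X | q \oc l = inj i}.
  exact/cid/simple_projective.
have [s [sP _]] := injP X (fun i => sval (lift i)).
exists s; have [w [_ wP]] := injP Y inj.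
rewrite -(wP (idm Y)); last by move=> i; rewrite comp1m.
by apply/esym/wP => i; rewrite -compmA sP (svalP (lift i)).
Qed.

(** Both the epimorphism onto the image and the cokernel split; a section of the
    cokernel amounts to a retraction of the image inclusion. *)
Lemma semisimple_regular X Y (u : hom X Y) :
  semisimple C -> exists x : hom Y X, u \oc x \oc u = u.
Proof.
move=> C_ss; have [I [Q [e [m [q [-> e_epi q_epi mP]]]]]] :=
  image_factorization u.
have [s es1] := semisimple_epi_split C_ss e_epi.
have [z qz1] := semisimple_epi_split C_ss q_epi.
have [qm0 mU] := mP.
have q_compl0 : q \oc (idm Y - z \oc q) = 0.
  by rewrite compmBr compm1 compmA qz1 comp1m subrr.
have [r [mr _]] := mU _ _ q_compl0.
have rm1 : r \oc m = idm I.
  apply: (kernel_mono mP).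
  by rewrite compmA mr compmBl comp1m -compmA qm0 compm0 subr0 compm1.
exists (s \oc r).
by rewrite !compmA -(compmA m e s) es1 compm1 -(compmA m r m) rm1 compm1.
Qed.

End Abelian.

(** * Natural loops and semiseparability *)

(** [T] is inert when some natural loop [X -> T X -> X] becomes the identity
    under [T].  For [T] the monad of an adjunction and [eta] its unit, such a
    [nu] is a natural quasi-inverse of [eta]; for a comonad the roles of [eta]
    and [nu] are exchanged, which is why neither is singled out. *)
Definition inert (C : categoryType) (T : functor C C) : Prop :=
  exists (eta : forall X : C, hom X (T X)) (nu : forall X : C, hom (T X) X),
    [/\ forall (X Y : C) (f : hom X Y), eta Y \oc f = fmap T f \oc eta X,
        forall (X Y : C) (f : hom X Y), nu Y \oc fmap T f = f \oc nu X &
        forall X : C, fmap T (nu X \oc eta X) = idm (T X)].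

(** [U] is a faithful functor defined on the full image of [F], with composite
    [T]; for (co)modules it forgets the (co)action. *)
Lemma semiseparable_inert (C D : categoryType) (F : functor C D)
    (T : functor C C)
    (U : forall X Y : C, hom (F X) (F Y) -> hom (T X) (T Y)) :
  (forall X Y : C, injective (@U X Y)) ->
  (forall (X Y Z : C) (g : hom (F Y) (F Z)) (h : hom (F X) (F Y)),
     U X Z (g \oc h) = U Y Z g \oc U X Y h) ->
  (forall (X Y : C) (f : hom X Y), U X Y (fmap F f) = fmap T f) ->
  inert T -> semiseparable F.
Proof.
move=> U_inj UM UF [eta [nu [eta_nat nu_nat loop]]].
exists (fun X Y h => nu Y \oc U X Y h \oc eta X).
- move=> X X' Y Y' f g h.
  by rewrite !UM !UF -!compmA -eta_nat !compmA nu_nat.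
- move=> X Y f; apply: U_inj.
  by rewrite !UF -compmA -eta_nat compmA fmapM loop comp1m.
Qed.

(** * Tensoring with an object that absorbs a scalar *)

Section Tensor.
Variable C : monoidalType.
Implicit Types A X : C.

Definition runitVm X : hom X (X \ox tens1) := eq_hom (esym (tenso1 X)).
Definition lunitVm X : hom X (tens1 \ox X) := eq_hom (esym (tens1o X)).

Lemma runitmV X : runitm X \oc runitVm X = idm X.
Proof. by rewrite eq_homM eq_hom_id. Qed.

Lemma runitVmK X : runitVm X \oc runitm X = idm _.
Proof. by rewrite eq_homM eq_hom_id. Qed.

Lemma lunitmV X : lunitm X \oc lunitVm X = idm X.
Proof. by rewrite eq_homM eq_hom_id. Qed.

Lemma lunitVmK X : lunitVm X \oc lunitm X = idm _.
Proof. by rewrite eq_homM eq_hom_id. Qed.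

Lemma runitVm_nat (X Y : C) (f : hom X Y) :
  runitVm Y \oc f = f \oxm idm tens1 \oc runitVm X.
Proof.
rewrite -[f in LHS]compm1 -(runitmV X) (compmA f) -tensm1 !compmA.
by rewrite runitVmK comp1m.
Qed.

Lemma lunitVm_nat (X Y : C) (f : hom X Y) :
  lunitVm Y \oc f = idm tens1 \oxm f \oc lunitVm X.
Proof.
rewrite -[f in LHS]compm1 -(lunitmV X) (compmA f) -tens1m !compmA.
by rewrite lunitVmK comp1m.
Qed.

(** The loop is [X = X (x) 1 -> X (x) A -> X (x) 1 = X], which is the scalar
    [b a] acting on [X]; by associativity [- (x) A] moves this scalar onto
    [A]. *)
Lemma rtensor_inert A (a : hom tens1 A) (b : hom A tens1) :
  (b \oc a) \oxm idm A = idm (tens1 \ox A) -> inert (rtensor A).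
Proof.
move=> ba1.
exists (fun X => idm X \oxm a \oc runitVm X).
exists (fun X => runitm X \oc (idm X \oxm b)); split=> [X Y f|X Y f|X] /=.
- by rewrite -compmA runitVm_nat !compmA -!tensmM !compm1 !comp1m.
- by rewrite -compmA -tensmM compmA -tensm1 -compmA -tensmM !compm1 !comp1m.
have scalar : (idm X \oxm (b \oc a)) \oxm idm A = idm _.
  rewrite -[LHS]comp1m -(assocVmK X tens1 A) -compmA assocm_nat ba1 tensm_id.
  by rewrite comp1m.
rewrite -!compmA (compmA (idm X \oxm b)) -tensmMr !tensmMl scalar comp1m.
by rewrite -tensmMl runitmV tensm_id.
Qed.

Lemma ltensor_inert A (a : hom tens1 A) (b : hom A tens1) :
  idm A \oxm (b \oc a) = idm (A \ox tens1) -> inert (ltensor A).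
Proof.
move=> ba1.
exists (fun X => a \oxm idm X \oc lunitVm X).
exists (fun X => lunitm X \oc (b \oxm idm X)); split=> [X Y f|X Y f|X] /=.
- by rewrite -compmA lunitVm_nat !compmA -!tensmM !compm1 !comp1m.
- by rewrite -compmA -tensmM compmA -tens1m -compmA -tensmM !compm1 !comp1m.
have scalar : idm A \oxm ((b \oc a) \oxm idm X) = idm _.
  rewrite -[LHS]comp1m -(assocmV A tens1 X) -compmA assocVm_nat ba1 tensm_id.
  by rewrite comp1m.
rewrite -!compmA (compmA (b \oxm idm X)) -tensmMl !tensmMr scalar comp1m.
by rewrite -tensmMr lunitmV tensm_id.
Qed.

Lemma algebra_absorbs (A : algebra C) (x : hom (alg_obj A) tens1) :
  aunit A \oc x \oc aunit A = aunit A ->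
  (x \oc aunit A) \oxm idm (alg_obj A) = idm _ /\
  idm (alg_obj A) \oxm (x \oc aunit A) = idm _.
Proof.
rewrite -compmA => uxu; split.
- rewrite -[LHS]comp1m -[in LHS]lunitVmK -(amul1l A) -!compmA -tensmMl uxu.
  by rewrite amul1l lunitVmK.
- rewrite -[LHS]comp1m -[in LHS]runitVmK -(amul1r A) -!compmA -tensmMr uxu.
  by rewrite amul1r runitVmK.
Qed.

Lemma coalgebra_absorbs (D : coalgebra C) (y : hom tens1 (coalg_obj D)) :
  counit D \oc y \oc counit D = counit D ->
  (counit D \oc y) \oxm idm (coalg_obj D) = idm _ /\
  idm (coalg_obj D) \oxm (counit D \oc y) = idm _.
Proof.
move=> eye; split.
- have counitVm : counit D \oxm idm _ \oc comul D = lunitVm (coalg_obj D).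
    rewrite -[LHS]comp1m -lunitVmK -!compmA (compmA (lunitm _)) comul1l.
    exact: compm1.
  rewrite -[LHS]compm1 -[in LHS]lunitVmK -counitVm !compmA -tensmMl eye counitVm.
  exact: lunitVmK.
- have counitVm : idm _ \oxm counit D \oc comul D = runitVm (coalg_obj D).
    rewrite -[LHS]comp1m -runitVmK -!compmA (compmA (runitm _)) comul1r.
    exact: compm1.
  rewrite -[LHS]compm1 -[in LHS]runitVmK -counitVm !compmA -tensmMr eye counitVm.
  exact: runitVmK.
Qed.

End Tensor.

Theorem proposition3p4 (C : abelianMonoidalType)
    (C_semisimple : semisimple C) (C_biexact : biexact_tensor C) :
  (forall A : algebra C,
     semiseparable (tensor_rmodule A) /\ semiseparable (tensor_lmodule A)) /\
  (forall D : coalgebra C,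
     semiseparable (tensor_rcomodule D) /\ semiseparable (tensor_lcomodule D)).
Proof.
split=> [A|D].
- have [x /algebra_absorbs[xuA Axu]] :=
    semisimple_regular (aunit A) C_semisimple.
  split.
  + apply: (@semiseparable_inert _ _ (tensor_rmodule A) (rtensor (alg_obj A))
      (fun X Y => @rmod_hom _ _ (free_rmodule A X) (free_rmodule A Y))) => //.
      by move=> X Y; exact: rmodule_hom_inj.
    exact: rtensor_inert xuA.
  + apply: (@semiseparable_inert _ _ (tensor_lmodule A) (ltensor (alg_obj A))
      (fun X Y => @lmod_hom _ _ (free_lmodule A X) (free_lmodule A Y))) => //.
      by move=> X Y; exact: lmodule_hom_inj.
    exact: ltensor_inert Axu.
- have [y /coalgebra_absorbs[eyD Dey]] :=
    semisimple_regular (counit D) C_semisimple.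
  split.
  + apply: (@semiseparable_inert _ _ (tensor_rcomodule D) (rtensor (coalg_obj D))
      (fun X Y =>
         @rcomod_hom _ _ (cofree_rcomodule D X) (cofree_rcomodule D Y))) => //.
      by move=> X Y; exact: rcomodule_hom_inj.
    exact: rtensor_inert eyD.
  + apply: (@semiseparable_inert _ _ (tensor_lcomodule D) (ltensor (coalg_obj D))
      (fun X Y =>
         @lcomod_hom _ _ (cofree_lcomodule D X) (cofree_lcomodule D Y))) => //.
      by move=> X Y; exact: lcomodule_hom_inj.
    exact: ltensor_inert Dey.
Qed.
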